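(* For every integer $r\ge 2$ there exists a constant $c>0$, not depending on $q$, such that for every integer $q\ge 2$, with $$m=\left\lceil (2q\ln q)^{\frac{1}{r-1}}\right\rceil,\qquad n=\left\lceil c\,r\,(q\ln q)^{\frac{r}{r-1}}\right\rceil,$$ one has $\mathrm{HG}(K_{m,\ldots,m,n})\ge q$, where $K_{m,\ldots,m,n}$ is the complete $r$-partite graph with $r-1$ vertex parts of size $m$ and one vertex part of size $n$. Consequently, for every fixed $r\ge2$, as $n\to\infty$, $$\mathrm{HG}(K_{n,\ldots,n})\ge n^{\frac{r-1}{r}-o(1)},$$ where $K_{n,\ldots,n}$ is the complete $r$-partite graph with all $r$ parts of size $n$.
   Context: Let $G$ be a finite simple graph with vertices $v_1,\ldots,v_n$ and let $[q]=\{1,\ldots,q\}$ be a set of $q$ colors. A coloring is any vector $x\in[q]^n$, where $x_i$ is the color of $v_i$. A guessing strategy is a choice, for each $i$, of a function $f_i$ with values in $[q]$ depending only on the colors of the neighbors of $v_i$; vertex $v_i$ guesses correctly on $x$ if $f_i(x)=x_i$. $G$ is $q$-solvable if there is a guessing strategy such that for every coloring $x\in[q]^n$ at least one vertex guesses correctly. The hat guessing number $\mathrm{HG}(G)$ is the largest positive integer $q$ such that $G$ is $q$-solvable. In a complete $r$-partite graph, two vertices are adjacent if and only if they lie in different parts. *)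

(* Defs.v *)
From mathcomp Require Import all_boot all_order all_algebra.
From mathcomp Require Import all_classical all_reals all_analysis.

Set Implicit Arguments.
Unset Strict Implicit.
Unset Printing Implicit Defensive.

Local Open Scope classical_set_scope.

Record sgraph := SGraph {
  vertex : finType;
  adj : rel vertex;
  adj_sym : symmetric adj;
  adj_irr : irreflexive adj
}.

(* The [q] colors are the elements of ['I_q]. *)
Definition coloring (G : sgraph) (q : nat) := {ffun vertex G -> 'I_q}.

Definition guessing_strategy (G : sgraph) (q : nat)
    (f : vertex G -> coloring G q -> 'I_q) : Prop :=
  forall (v : vertex G) (x y : coloring G q),
    (forall w, adj v w -> x w = y w) -> f v x = f v y.

Definition solvable (G : sgraph) (q : nat) : Prop :=
  exists f : vertex G -> coloring G q -> 'I_q,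
    guessing_strategy f /\
    forall x : coloring G q, exists v : vertex G, f v x = x v.

Definition is_HG (G : sgraph) (h : nat) : Prop :=
  [/\ 0 < h, solvable G h & forall q, 0 < q -> solvable G q -> q <= h].

(* The value is [0] only for the graph without vertices, which is [q]-solvable
   for no positive [q]; see [HGP]. *)
Definition HG (G : sgraph) : nat := xget 0 [set h | is_HG G h].

Lemma solvable_leq_card (G : sgraph) (q : nat) :
  0 < q -> solvable G q -> q <= #|vertex G|.
Proof.
move=> q0 [f [floc fwin]].
pose A v := [set x : coloring G q | f v x == x v]%SET.
pose N := #|{: coloring G q}|.
have N0 : 0 < N by apply/card_gt0P; exists [ffun=> Ordinal q0].
have cardA v : #|A v| * q <= N.
  pose g (p : coloring G q * 'I_q) : coloring G q :=
    [ffun w => if w == v then p.2 else p.1 w].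
  have -> : #|A v| * q = #|finset.setX (A v) (finset.setTfor 'I_q)|.
    by rewrite finset.cardsX finset.cardsT card_ord.
  have fg p : f v (g p) = f v p.1.
    apply: floc => w vw; rewrite ffunE; case: eqP => // wv.
    by rewrite wv adj_irr in vw.
  rewrite -(@card_in_imset _ _ g) ?max_card// => -[x c] [y d] /=.
  rewrite !inE/= !andbT => /eqP fx /eqP fy gxy.
  have xv : x v = y v by rewrite -fx -fy -(fg (x, c)) -(fg (y, d)) gxy.
  congr pair; last by move/ffunP/(_ v): gxy; rewrite !ffunE eqxx.
  apply/ffunP => w; have [->//|wv] := eqVneq w v.
  by move/ffunP/(_ w): gxy; rewrite !ffunE (negPf wv).
have NA : N <= \sum_v #|A v|.
  rewrite (eq_bigr (fun v => \sum_x (x \in A v))); last first.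
    by move=> v _; rewrite -sum1_card big_mkcond.
  rewrite exchange_big/= /N -sum1_card; apply: leq_sum => x _.
  have [v fv] := fwin x.
  by rewrite (bigD1 v)//= inE fv eqxx.
rewrite -(leq_pmul2l N0); apply: leq_trans (leq_mul NA (leqnn q)) _.
rewrite big_distrl/=; apply: (@leq_trans (\sum_(v : vertex G) N)).
  exact: leq_sum.
by rewrite sum_nat_const mulnC.
Qed.

Lemma HGP (G : sgraph) : 0 < #|vertex G| -> is_HG G (HG G).
Proof.
move=> /card_gt0P[v0 _].
have s1 : solvable G 1.
  exists (fun _ _ => ord0); split=> // x.
  by exists v0; rewrite [RHS]ord1.
pose P q := (0 < q) && `[< solvable G q >].
have exP : exists q, P q by exists 1; apply/andP; split=> //; apply/asboolP.
have ubP q : P q -> q <= #|vertex G|.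
  by case/andP => q0 /asboolP; exact: solvable_leq_card.
case: (ex_maxnP exP ubP) => h /andP[h0 /asboolP hs] hmax.
apply: (@xgetPex _ 0 [set h | is_HG G h]); exists h; split=> // q q0 qs.
by apply: hmax; apply/andP; split=> //; apply/asboolP.
Qed.

Section CompleteMultipartite.
Variables (r : nat) (k : 'I_r -> nat).

(* The vertex [Tagged _ j] with tag [i] is the [j]-th vertex of part [i]. *)
Definition multipartite_adj : rel {i : 'I_r & 'I_(k i)} :=
  fun u v => tag u != tag v.

Lemma multipartite_adj_sym : symmetric multipartite_adj.
Proof. by move=> u v; rewrite /multipartite_adj eq_sym. Qed.

Lemma multipartite_adj_irr : irreflexive multipartite_adj.
Proof. by move=> u; rewrite /multipartite_adj eqxx. Qed.

Definition complete_multipartite : sgraph :=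
  SGraph multipartite_adj_sym multipartite_adj_irr.

End CompleteMultipartite.

Definition K_one_large (r m n : nat) : sgraph :=
  complete_multipartite (fun i : 'I_r => if i.+1 == r then n else m).

Definition K_balanced (r n : nat) : sgraph :=
  complete_multipartite (fun _ : 'I_r => n).

(* Main.v *)
Require Import Defs.
From mathcomp Require Import all_boot all_order all_algebra.
From mathcomp Require Import all_classical all_reals all_analysis.
From mathcomp Require Import ring lra zify.
Import Order.TTheory GRing.Theory Num.Theory.
Import numFieldNormedType.Exports.
Set Implicit Arguments.
Unset Strict Implicit.
Unset Printing Implicit Defensive.

(** Write [t = r - 1].  The idea is to let the large part guess by a random
rule and to let the [t] small parts repair what is left.

Suppose that every vertex of the large part, which sees the colors [x] of all
small parts, guesses by an independent uniformly random function of [x].  For a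
coloring [y] of the large part, call [x] missed when all these vertices guess
wrong.  A given set of [s] colorings [x] is missed entirely with probability
[(1 - 1/q)^(n s) <= exp (- n s / q)], and there are at most [q^n] choices of
[y] and [q^(m t s)] choices of the set.  Since [s = m^t] is at least
[2 q ln q], the first factor is at most [exp (n s / (2 q))]; since [n] exceeds
[2 m t q ln q], the second is smaller than that, so some choice of the random functions misses fewer than
[m^t] colorings for every [y] ([exists_few_bad], [union_bound_holds]).

The small parts all see [y], hence know the set of missed colorings, and a set
of fewer than [m^t] colorings of [t] parts of size [m] can always be covered by
a strategy of those parts alone ([cover_few_colorings]).  A part sees the
projection of the coloring to the other parts; when fewer than [m] members of
the set share this projection, each vertex of the part bets on its own
candidate and one of them is right.  The projections shared by [m] or more
members number fewer than [m^(t-1)], and the other parts win on them by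
induction.

For the balanced graph, [K_{m,...,m,n}] embeds into [K_{N,...,N}] as soon as
[N] is at least [8 r (q ln q)^(r/t)].  The largest [q] allowed is of order
[N^(t/r) / ln N], and the factor [ln N] is [N^(o(1))]
([HG_K_balanced_ge], [cvg_ln_div_ln]). *)

(** * A union bound *)

Lemma bin_leq_expn n s : 'C(n, s) <= n ^ s.
Proof.
apply: (@leq_trans (n ^_ s)).
  by rewrite -bin_ffact leq_pmulr ?fact_gt0.
elim: s => // s IHs; rewrite ffactnSr expnSr.
by rewrite leq_mul ?leq_subr.
Qed.

(** The first moment method, done by counting.  If a uniformly random element of
[A] is bad for [y] with probability at most [b / #|A|], then for fixed [y] a
random [F : X -> A] is bad on all of a given [s]-set with probability at most
[(b / #|A|) ^ s].  There are at most [#|Y| * #|X| ^ s] pairs of a [y] and an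
[s]-set, so the hypothesis leaves an [F] that no pair ruins. *)
Lemma exists_few_bad (X A Y : finType) (bad : A -> pred Y) (b s : nat) :
  0 < s ->
  (forall y, #|[pred a | bad a y]| <= b) ->
  #|Y| * #|X| ^ s * b ^ s < #|A| ^ s ->
  exists F : {ffun X -> A}, forall y, #|[pred x | bad (F x) y]| < s.
Proof.
move=> s0 bad_le count.
pose draws : {set {set X}} := [set S : {set X} | #|S| == s]%SET.
pose ruined (y : Y) (S : {set X}) : {set {ffun X -> A}} :=
  [set F : {ffun X -> A} | [forall x in S, bad (F x) y]]%SET.
have card_ruined y S : S \in draws ->
    #|ruined y S| * #|A| ^ s <= b ^ s * #|A| ^ #|X|.
  rewrite inE => /eqP cS.
  pose fam x := if x \in S then [pred a | bad a y] else predT.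
  have -> : #|ruined y S| = #|family fam|.
    apply: eq_card => F; rewrite inE; apply/forall_inP/familyP => HF x.
      by rewrite /fam; case: ifPn => // /HF.
    by move=> xS; have := HF x; rewrite /fam xS.
  rewrite card_family foldrE big_map big_enum/= (bigID (mem S))/=.
  rewrite (eq_bigr (fun=> #|[pred a | bad a y]|)); last first.
    by move=> x xS; apply: eq_card => a; rewrite /fam xS.
  rewrite [X in _ * X * _](eq_bigr (fun=> #|A|)); last first.
    by move=> x xS; apply: eq_card => a; rewrite /fam (negPf xS).
  rewrite !prod_nat_const -mulnA -expnD cS.
  have -> : #|[pred x | x \notin S]| + s = #|X|.
    by rewrite -cS addnC cardC.
  by rewrite leq_mul2r; apply/orP; right; case: (s) => // u; rewrite leq_exp2r.
have [F FP] : exists F, forall y S, S \in draws -> F \notin ruined y S.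
  (* Otherwise the ruined sets cover all functions, against their total size. *)
  apply: contrapT => noF.
  have A0 : 0 < #|A|.
    by move: (leq_ltn_trans (leq0n _) count); rewrite expn_gt0 eqn0Ngt s0 orbF.
  have AX0 : 0 < #|A| ^ #|X| by rewrite expn_gt0 A0.
  have cover : #|{ffun X -> A}| <= \sum_y \sum_(S in draws) #|ruined y S|.
    under eq_bigr do under eq_bigr do rewrite -sum1_card big_mkcond.
    under eq_bigr do rewrite exchange_big/=.
    rewrite exchange_big/= -sum1_card; apply: leq_sum => F _.
    rewrite lt0n; apply/negP => /eqP sum0; apply: noF; exists F => y S dS.
    apply/negP => rF; move: sum0.
    by rewrite (bigD1 y)//= (bigD1 S)//= rF.
  have : #|{ffun X -> A}| * #|A| ^ s <=
      #|Y| * 'C(#|X|, s) * (b ^ s * #|A| ^ #|X|).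
    apply: leq_trans (leq_mul cover (leqnn _)) _.
    rewrite big_distrl/= -mulnA -sum_nat_const; apply: leq_sum => y _.
    rewrite big_distrl/= -card_draws -sum_nat_const; apply: leq_sum => S.
    exact: card_ruined.
  rewrite card_ffun mulnA [leqRHS]mulnC leq_pmul2l// leqNgt => /negP; apply.
  apply: leq_ltn_trans count.
  by rewrite leq_mul2r leq_mul2l bin_leq_expn !orbT.
(* A bad set with at least [s] elements would contain a forbidden [s]-set. *)
exists F => y; rewrite ltnNge; apply/negP => sle.
have : 0 < #|[set S : {set X} | S \subset [set x | bad (F x) y] & #|S| == s]%SET|.
  by rewrite cards_draws bin_gt0 cardsE.
case/card_gt0P => S; rewrite inE => /andP[/fintype.subsetP SP cS].
have := FP y S; rewrite !inE cS => /(_ isT)/negP; apply.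
by apply/forall_inP => x /SP; rewrite inE.
Qed.

(** * Covering few colorings by the small parts *)

(** The first condition on [f] makes it a strategy that reads only the parts in
[P]; the induction needs this, because the parts [P] of [i :: P] must play on
the projection of the coloring, in which the colors of part [i] are lost.
Projections are encoded as colorings that are constant outside [P].  With the
strict bound the induction can start at [P = [::]], where no vertex is there to
guess and [S] has to be empty. *)
Lemma cover_few_colorings (r : nat) (k : 'I_r -> nat) (q : nat) (P : seq 'I_r)
    (S : {set coloring (complete_multipartite k) q}) :
  0 < q -> uniq P -> #|S| < \prod_(i <- P) k i ->
  exists f : vertex (complete_multipartite k) ->
             coloring (complete_multipartite k) q -> 'I_q,
    (forall v (x y : coloring (complete_multipartite k) q),
       (forall w, tag w \in P -> tag v != tag w -> x w = y w) ->
       f v x = f v y) /\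
    forall x, x \in S -> exists2 v, tag v \in P & f v x = x v.
Proof.
move=> q0; pose c0 := Ordinal q0.
elim: P S => [|i P IHP] S /=.
  rewrite big_nil ltnS leqn0 cards_eq0 => _ /eqP S0.
  by exists (fun _ _ => c0); split=> // x; rewrite S0 inE.
move=> /andP[iP uP]; rewrite big_cons => cS.
pose proj (x : coloring (complete_multipartite k) q) :
    coloring (complete_multipartite k) q :=
  [ffun v => if tag v \in P then x v else c0].
pose fiber (z : coloring (complete_multipartite k) q) := [set x in S | proj x == z]%SET.
(* The projections whose fiber is too large for part [i] to handle. *)
pose S' := [set z in (proj @: S)%SET | k i <= #|fiber z|]%SET.
have cS' : #|S'| < \prod_(j <- P) k j.
  suff : k i * #|S'| < k i * \prod_(j <- P) k j.
    by rewrite ltn_mul2l => /andP[].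
  apply: leq_ltn_trans cS.
  rewrite -[#|S|]sum1_card (partition_big_imset proj)/= mulnC -sum_nat_const.
  rewrite [leqRHS](bigID (fun z => k i <= #|fiber z|))/=.
  apply: leq_trans (leq_addr _ _).
  rewrite [leqLHS](eq_bigl (fun z => (z \in (proj @: S)%SET) && (k i <= #|fiber z|))).
    apply: leq_sum => z /andP[_] /leq_trans; apply.
    by rewrite -sum1_card; apply/eq_leq/eq_bigl => x; rewrite inE.
  by move=> z; rewrite inE.
have [f' [f'_loc f'_win]] := IHP S' uP cS'.
(* On a small fiber, vertex [j] of part [i] bets on the [j]-th member. *)
pose entry (j : nat) (x : coloring (complete_multipartite k) q) :
    coloring (complete_multipartite k) q :=
  nth [ffun=> c0] (enum (fiber (proj x))) j.
pose f (v : vertex (complete_multipartite k))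
    (x : coloring (complete_multipartite k) q) :=
  if tag v == i then entry (tagged v : 'I_(k (tag v))) x v else f' v x.
exists f; split.
  move=> v x y xy; rewrite /f /entry; case: ifPn => [/eqP vi|_].
    suff -> : proj x = proj y by [].
    apply/ffunP => w; rewrite !ffunE; case: ifPn => // wP.
    apply: xy; first by rewrite inE wP orbT.
    by rewrite vi; apply: contraNneq iP => ->.
  by apply: f'_loc => w wP vw; apply: xy => //; rewrite inE wP orbT.
move=> x xS.
have xfib : x \in fiber (proj x) by rewrite inE xS eqxx.
have [big|small] := leqP (k i) #|fiber (proj x)|.
  have [|v vP fv] := f'_win (proj x); first by rewrite inE imset_f.
  exists v; first by rewrite inE vP orbT.
  have -> : f v x = f' v x.
    by rewrite /f; case: eqP => // vi; rewrite -vi vP in iP.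
  transitivity (f' v (proj x)).
    by apply: f'_loc => w wP _; rewrite ffunE wP.
  by rewrite fv ffunE vP.
have lt_ix : index x (enum (fiber (proj x))) < k i.
  by apply: leq_trans small; rewrite ltnS ltnW// cardE index_mem mem_enum.
exists (Tagged (fun i => 'I_(k i)) (Ordinal lt_ix)); first by rewrite inE eqxx.
by rewrite /f /entry/= eqxx nth_index ?mem_enum.
Qed.

(** * Strategies on complete multipartite graphs *)

Lemma card_parts (r : nat) (k : 'I_r -> nat) (P : pred 'I_r) :
  #|{: {v : vertex (complete_multipartite k) | P (tag v)}}| =
  \sum_(i | P i) k i.
Proof.
transitivity (\sum_(i | P i) \sum_(j : 'I_(k i) | true) 1).
  rewrite (sig_big_dep P (fun _ _ => true) (fun _ _ => 1))/= card_sig -sum1_card.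
  by apply: eq_bigl => v; rewrite andbT.
by apply: eq_bigr => i _; rewrite sum1_card card_ord.
Qed.

(** The vertices of part [i0] guess by the function [F] of [exists_few_bad]; the
other parts cover the few colorings [missed y] that this fails on.  A vertex
outside [i0] sees the whole of [y], so its strategy may depend on [y].  The
third hypothesis says that the union bound succeeds: [q ^ M] counts the
colorings of the other parts, and [q.-1 ^ n] the vectors of guesses that are
wrong everywhere for a given [y]. *)
Lemma solvable_multipartite (r : nat) (k : 'I_r -> nat) (q : nat) (i0 : 'I_r) :
  let n := k i0 in
  let M := \sum_(i | i != i0) k i in
  let s := \prod_(i | i != i0) k i in
  0 < q -> 0 < s ->
  q ^ n * (q ^ M) ^ s * (q.-1 ^ n) ^ s < (q ^ n) ^ s ->
  solvable (complete_multipartite k) q.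
Proof.
move=> n M s q0 s0 count.
set G := complete_multipartite k.
pose U := {v : vertex G | tag v == i0}.
pose W := {v : vertex G | tag v != i0}.
have card_U : #|{: U}| = n.
  by rewrite (card_parts k (fun i => i == i0)) big_pred1_eq.
have card_W : #|{: W}| = M by exact: (card_parts k (fun i => i != i0)).
pose avoids (a y : {ffun U -> 'I_q}) := [forall u, a u != y u].
have [F FP] : exists F : {ffun {ffun W -> 'I_q} -> {ffun U -> 'I_q}},
    forall y, #|[pred x | avoids (F x) y]| < s.
  apply: (@exists_few_bad {ffun W -> 'I_q} {ffun U -> 'I_q} {ffun U -> 'I_q}
    avoids (q.-1 ^ n)) => // [y|].
    apply: eq_leq.
    transitivity #|family (fun u => predC1 (y u))|.
      by apply: eq_card => a; rewrite inE.
    rewrite card_family foldrE big_map big_enum/=.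
    rewrite (eq_bigr (fun=> q.-1)) => [|u _].
      by rewrite prod_nat_const card_U.
    by rewrite (cardC1 (y u)) card_ord.
  by rewrite !card_ffun card_U card_W !card_ord.
pose xU (x : coloring G q) : {ffun U -> 'I_q} := [ffun u => x (val u)].
pose xW (x : coloring G q) : {ffun W -> 'I_q} := [ffun w => x (val w)].
pose missed y := [set x | (xU x == y) && avoids (F (xW x)) y]%SET.
have cmissed y : #|missed y| < \prod_(i <- enum (predC1 i0)) k i.
  rewrite big_enum/=; apply: leq_ltn_trans (FP y).
  rewrite -(@card_in_imset _ _ xW).
    apply/subset_leq_card/fintype.subsetP => _ /imsetP[x + ->].
    by rewrite !inE => /andP[].
  move=> x z; rewrite !inE => /andP[/eqP xy _] /andP[/eqP zy _] xz.
  apply/ffunP => v; case: (boolP (tag v == i0)) => vi.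
    by have /ffunP/(_ (exist _ v vi)) := etrans xy (esym zy); rewrite !ffunE.
  by have /ffunP/(_ (exist _ v vi)) := xz; rewrite !ffunE.
have [g gP] := choice (fun y => cover_few_colorings q0 (enum_uniq _) (cmissed y)).
exists (fun v x => if insub v is Some u then F (xW x) u else g (xU x) v x).
split=> [v x y xy|x].
  case: insubP => [u _ uv|vi].
    suff -> : xW x = xW y by [].
    apply/ffunP => -[w wi]; rewrite !ffunE/=; apply: xy.
    by rewrite /= /multipartite_adj -uv (eqP (valP u)) eq_sym.
  have -> : xU x = xU y.
    apply/ffunP => -[w wi]; rewrite !ffunE/=; apply: xy.
    by rewrite /= /multipartite_adj (eqP wi).
  by apply: (gP _).1 => w _; exact: xy.
have [/forallP missx|] := boolP (avoids (F (xW x)) (xU x)).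
  have [|v vP gv] := (gP (xU x)).2 x.
    by rewrite inE eqxx; apply/forallP.
  exists v; rewrite insubN//.
  by move: vP; rewrite mem_enum.
rewrite /avoids negb_forall => /existsP[u]; rewrite negbK => /eqP Fu.
by exists (val u); rewrite valK Fu ffunE.
Qed.

(** The vertices in the image of [h] play the strategy of [G], all others guess a
fixed color. *)
Lemma solvable_embed (G H : sgraph) (q : nat) (h : vertex G -> vertex H) :
  injective h -> (forall v w, adj v w -> adj (h v) (h w)) -> 0 < q ->
  solvable G q -> solvable H q.
Proof.
move=> h_inj h_adj q0 [f [f_loc f_win]].
pose pull (x : coloring H q) : coloring G q := [ffun v => x (h v)].
exists (fun v x => if [pick u | h u == v] is Some u then f u (pull x)
                   else Ordinal q0); split=> [v x y xy|x].
  case: pickP => // u /eqP uv; apply: f_loc => w uw.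
  by rewrite !ffunE; apply: xy; rewrite -uv; exact: h_adj.
have [v fv] := f_win (pull x); exists (h v).
case: pickP => [u /eqP/h_inj ->|/(_ v)]; last by rewrite eqxx.
by rewrite fv ffunE.
Qed.

Lemma solvable_multipartite_le (r : nat) (k k' : 'I_r -> nat) (q : nat) :
  (forall i, k i <= k' i) -> 0 < q ->
  solvable (complete_multipartite k) q -> solvable (complete_multipartite k') q.
Proof.
move=> kk'; apply: (@solvable_embed (complete_multipartite k)
  (complete_multipartite k') q
  (fun v => Tagged (fun i => 'I_(k' i)) (widen_ord (kk' (tag v)) (tagged v)))).
  move=> [i a] [j b] /= /eqP; rewrite -tag_eqE /tag_eq/= => /andP[/eqP ij].
  case: j / ij b => b; rewrite tagged_asE => /eqP/(congr1 val)/= ab.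
  by have -> : a = b by exact: val_inj.
by [].
Qed.

Lemma solvable_leq_HG (G : sgraph) (q : nat) : 0 < q -> solvable G q -> q <= HG G.
Proof.
move=> q0 Gq; have V0 : 0 < #|vertex G|.
  exact: leq_trans q0 (solvable_leq_card q0 Gq).
by have [_ _] := HGP V0; apply.
Qed.

Local Open Scope classical_set_scope.
Local Open Scope ring_scope.

(** * The sizes of the parts *)

(** With [L = q ln q] and after taking logarithms, the claim is
[(n + M s) L < n s]; each hypothesis bounds one of the two terms on the left by
half of the right-hand side. *)
Lemma union_bound_holds (R : realType) (q n M s : nat) : (1 < q)%N ->
  2 * (q%:R * ln q%:R) <= s%:R :> R -> 2 * M%:R * (q%:R * ln q%:R) < n%:R :> R ->
  (q ^ n * (q ^ M) ^ s * (q.-1 ^ n) ^ s < (q ^ n) ^ s)%N.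
Proof.
move=> q1 sL nL.
have q0 : 0 < q%:R :> R by rewrite ltr0n ltnW.
have lnq : 0 < ln (q%:R : R) by rewrite ln_gt0// ltr1n.
have s0 : 0 < s%:R :> R by apply: lt_le_trans sL; rewrite !mulr_gt0.
have pred_le : q.-1%:R <= q%:R * expR (- q%:R^-1) :> R.
  rewrite -subn1 natrB ?(ltnW q1)// -[leLHS](_ : q%:R * (1 - q%:R^-1) = _).
    by rewrite ler_pM2l// expR_ge1Dx.
  by rewrite mulrBr mulr1 divff ?gt_eqF.
rewrite -!expnM -expnD -(ltr_nat R) natrM !natrX.
apply: (@le_lt_trans _ _
   (q%:R ^+ (n + M * s) * (q%:R * expR (- q%:R^-1)) ^+ (n * s))).
  by rewrite ler_pM2l ?exprn_gt0// lerXn2r ?nnegrE// ltW// mulr_gt0 ?expR_gt0.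
rewrite exprMn mulrCA gtr_pMr ?exprn_gt0// -{1}(lnK q0) -!expRM_natl -expRD.
rewrite expR_lt1 -(pmulr_rlt0 _ q0) natrD !natrM.
(* The exponent is multiplied by [q] to clear the denominator. *)
have -> : q%:R * ((n%:R + M%:R * s%:R) * ln q%:R + n%:R * s%:R * - q%:R^-1) =
    (n%:R + M%:R * s%:R) * (q%:R * ln q%:R) - n%:R * s%:R :> R.
  by field; rewrite gt_eqF.
have n0 : 0 <= n%:R :> R by [].
have nsL := ler_wpM2l n0 sL.
have MsL : 2 * M%:R * (q%:R * ln q%:R) * s%:R < n%:R * s%:R :> R.
  by rewrite ltr_pM2r.
lra.
Qed.

Lemma solvable_K_one_large (R : realType) (t m n q : nat) : (1 < q)%N ->
  2 * (q%:R * ln q%:R) <= (m ^ t)%:R :> R ->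
  2 * (t * m)%:R * (q%:R * ln q%:R) < n%:R :> R ->
  solvable (K_one_large t.+1 m n) q.
Proof.
move=> q1 sL nL.
pose k (i : 'I_t.+1) := if i.+1 == t.+1 then n else m.
have k_max : k ord_max = n by rewrite /k eqxx.
have k_other i : i != ord_max -> k i = m.
  by rewrite /k eqSS -(inj_eq val_inj) => /negPf ->.
have card_other : #|[pred i : 'I_t.+1 | i != ord_max]| = t.
  by rewrite (cardC1 ord_max) card_ord.
have M_E : (\sum_(i | i != ord_max) k i = t * m)%N.
  by rewrite (eq_bigr _ k_other) sum_nat_const card_other.
have s_E : (\prod_(i | i != ord_max) k i = m ^ t)%N.
  by rewrite (eq_bigr _ k_other) prod_nat_const card_other.
apply: (@solvable_multipartite _ k _ ord_max); first exact: ltnW.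
  rewrite s_E -(ltr0n R); apply: lt_le_trans sL.
  by rewrite !mulr_gt0// ?ltr0n ?ln_gt0 ?ltr1n// ltnW.
by rewrite k_max M_E s_E; exact: (@union_bound_holds R).
Qed.

Lemma natr_abs_ceil (R : realType) (x : R) : 0 <= x ->
  (`|Num.ceil x|%N)%:R = (Num.ceil x)%:~R :> R.
Proof.
move=> x0; rewrite natr_absz ger0_norm// ceil_ge0.
by apply: lt_le_trans x0; rewrite oppr_lt0.
Qed.

Lemma abs_ceil_le (R : realType) (x : R) (N : nat) : 0 <= x -> x <= N%:R ->
  (`|Num.ceil x| <= N)%N.
Proof.
move=> x0 xN; rewrite -(ler_nat R) natr_abs_ceil//.
by rewrite (_ : N%:R = N%:Z%:~R)// ler_int ceil_le_int.
Qed.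

Lemma half_le_ln2 (R : realType) : 1 / 2 <= ln 2 :> R.
Proof.
have := @le_ln1Dx R (- (1 / 2)); rewrite (_ : 1 + - (1 / 2) = 2^-1); last by lra.
by rewrite lnV ?posrE//; lra.
Qed.

(** For [q >= 2] the rounding up of the part sizes costs only a constant factor,
because [q ln q] is bounded below by [1]. *)
Lemma qlnq_ge1 (R : realType) (q : nat) : (1 < q)%N -> 1 <= q%:R * ln q%:R :> R.
Proof.
move=> q1; have q2 : 2 <= q%:R :> R by rewrite ler_nat.
have : ln 2 <= ln q%:R :> R by rewrite ler_ln ?posrE//; lra.
have := half_le_ln2 R; nra.
Qed.

(** With [z = L ^ (1/t)], rounding gives [m < 2 z + 1 <= 3 z], so that
[2 t m L < 6 t z L], which is less than [8 (t + 1) z L = 8 r L ^ (r/t)]; this is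
where the constant [8] comes from. *)
Lemma solvable_K_one_large_ceil (R : realType) (t q : nat) :
  (0 < t)%N -> (1 < q)%N ->
  let L : R := q%:R * ln q%:R in
  solvable (K_one_large t.+1 `|Num.ceil ((2 * L) `^ (1 / t%:R))|%N
    `|Num.ceil (8 * t.+1%:R * L `^ (t.+1%:R / t%:R))|%N) q.
Proof.
move=> t0 q1 L; have L1 : 1 <= L by exact: qlnq_ge1.
have L0 : 0 < L by lra.
have tR0 : 0 < t%:R :> R by rewrite ltr0n.
have tR1 : 1 <= t%:R :> R by rewrite ler1n.
set x := (2 * L) `^ _; set y := _ * L `^ _.
have x0 : 0 <= x by rewrite powR_ge0.
have y0 : 0 <= y by rewrite !mulr_ge0// powR_ge0.
apply: (@solvable_K_one_large R) => //; rewrite -/L.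
  have -> : 2 * L = x ^+ t.
    by rewrite -powR_mulrn// -powRrM mul1r mulVf ?gt_eqF// powRr1//; lra.
  by rewrite natrX lerXn2r ?nnegrE// natr_abs_ceil// ceil_ge.
rewrite (@natr_abs_ceil _ y)//; apply: lt_le_trans (ceil_ge y).
pose z := L `^ (1 / t%:R).
have z1 : 1 <= z.
  by rewrite /z -[leLHS](powRr0 L) ler_powR// divr_ge0.
have yE : y = 8 * (t%:R + 1) * (z * L).
  have -> : y = 8 * (t%:R + 1) * L `^ (1 + 1 / t%:R).
    by rewrite /y -[t.+1%:R]natr1 (mulrDl _ _ t%:R^-1) divff ?gt_eqF.
  rewrite powRD; last first.
    by rewrite (gt_eqF L0) implybT.
  by rewrite powRr1 ?(ltW L0)// [L * _]mulrC.
have xz : x <= 2 * z.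
  rewrite /x powRM ?ler_wpM2r ?powR_ge0 ?(ltW L0)//.
  by rewrite ler1_powR// ?ler1n// ler_pdivrMr// mul1r.
have m_lt : (`|Num.ceil x|%N)%:R < x + 1.
  rewrite natr_abs_ceil//; have := ceilB1_lt x; rewrite intrD; lra.
have m3 : (`|Num.ceil x|%N)%:R < 3 * z by lra.
rewrite natrM yE.
apply: (@le_lt_trans _ _ (2 * (t%:R * (3 * z)) * L)).
  by rewrite ler_pM2r// ler_pM2l// ler_pM2l// ltW.
have zL : 0 < z * L by rewrite mulr_gt0//; lra.
nra.
Qed.

(** The balanced graph contains [K_{m,...,m,n}] once [N] is at least [n], since
[m <= n]. *)
Lemma solvable_K_balanced (R : realType) (t q N : nat) :
  (0 < t)%N -> (1 < q)%N ->
  8 * t.+1%:R * (q%:R * ln q%:R) `^ (t.+1%:R / t%:R) <= N%:R :> R ->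
  solvable (K_balanced t.+1 N) q.
Proof.
move=> t0 q1; set L := q%:R * _ => LN.
have L1 : 1 <= L by exact: qlnq_ge1.
have L0 : 0 < L by lra.
have tR0 : 0 < t%:R :> R by rewrite ltr0n.
have tR1 : 1 <= t%:R :> R by rewrite ler1n.
have /(solvable_multipartite_le _ _) := solvable_K_one_large_ceil R t0 q1.
apply; last exact: ltnW.
move=> i; case: ifP => _; apply: abs_ceil_le; rewrite ?mulr_ge0 ?powR_ge0//.
apply: le_trans LN.
apply: (@le_trans _ _ (2 * L `^ (1 / t%:R))).
  rewrite powRM ?ler_wpM2r ?powR_ge0 ?(ltW L0)//.
  by rewrite ler1_powR// ?ler1n// ler_pdivrMr// mul1r.
apply: ler_pM; rewrite ?powR_ge0//.
  by rewrite -natrM ler_nat; lia.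
by rewrite ler_powR// ler_pM2r ?invr_gt0// ler1n.
Qed.

(** * Asymptotics for the balanced graph *)

Lemma cvgy_ln_natr (R : realType) : ln (n%:R : R) @[n --> \oo] --> +oo.
Proof.
apply/cvgryPge => A.
have : \forall n \near \oo, expR A <= n%:R :> R.
  by apply: cvgry_ge; exact: cvgr_idn.
apply: filterS => n An; have n0 := lt_le_trans (expR_gt0 A) An.
by rewrite -[leLHS]expRK ler_ln// posrE// expR_gt0.
Qed.

Lemma ln_le_sqrt (R : realType) (x : R) : 0 < x -> ln x <= 2 * Num.sqrt x.
Proof.
move=> x0; rewrite -{1}[x]sqr_sqrtr ?(ltW x0)// lnXn ?sqrtr_gt0//.
by rewrite -[leLHS]mulr_natl ler_pM2l// ltW// ln_sublinear// sqrtr_gt0.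
Qed.

(** With [u = ln n], the quotient [ln (C u) / u] is at most
[2 sqrt (C u) / u], which tends to [0] as [u] grows. *)
Lemma cvg_ln_div_ln (R : realType) (C : R) : 0 < C ->
  ln (C * ln n%:R) / ln (n%:R : R) @[n --> \oo] --> (0 : R).
Proof.
move=> C0; apply/cvgr0Pnorm_le => e e0.
(* The first bound makes the quotient nonnegative, the second makes it small. *)
pose B := Num.max C^-1 (C * (2 / e) ^+ 2).
have : \forall n \near \oo, B <= ln (n%:R : R).
  by apply: cvgry_ge; exact: cvgy_ln_natr.
apply: filterS => n; set u := ln _; rewrite ge_max => /andP[uC ue].
have u0 : 0 < u by apply: lt_le_trans uC; rewrite invr_gt0.
have Cu0 : 0 < C * u by rewrite mulr_gt0.
have Cu1 : 1 <= C * u by rewrite -ler_pdivrMl// mulr1.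
rewrite ger0_norm; last by rewrite divr_ge0 ?(ltW u0) ?(ln_ge0 Cu1).
rewrite ler_pdivrMr//.
apply: le_trans (ln_le_sqrt Cu0) _.
have e2 : 0 <= e / 2 * u by rewrite mulr_ge0 ?ltW// divr_gt0.
suff : Num.sqrt (C * u) <= e / 2 * u by lra.
rewrite -[leRHS](ger0_norm e2) -sqrtr_sqr.
rewrite ler_wsqrtr// exprMn.
have -> : C * u = (e / 2) ^+ 2 * (C * (2 / e) ^+ 2 * u).
  by field; rewrite gt_eqF.
by rewrite ler_pM2l ?exprn_gt0 ?divr_gt0// expr2 ler_wpM2r// ltW.
Qed.

(** The error term [o1 = ln (C ln N) / ln N] satisfies [N ^ o1 = C ln N].  Hence
[x = N ^ (t/(t+1) - o1)] equals [N ^ (t/(t+1)) / (C ln N)], and [q] can be taken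
between [x] and [2 x]: the factor [2] absorbs the rounding, as [x >= 1]. *)
Lemma HG_K_balanced_ge (R : realType) (t : nat) : (0 < t)%N ->
  let C : R := 16 * t.+1%:R in
  \forall N \near \oo,
    (N%:R : R) `^ (t%:R / t.+1%:R - ln (C * ln N%:R) / ln N%:R)
      <= (HG (K_balanced t.+1 N))%:R.
Proof.
move=> t0 C.
have C0 : 0 < C by rewrite mulr_gt0// ltr0n.
have tR0 : 0 < t%:R :> R by rewrite ltr0n.
have t1R0 : 0 < t.+1%:R :> R by rewrite ltr0n.
pose a : R := t%:R / t.+1%:R.
have a0 : 0 < a by rewrite divr_gt0.
have a1 : a <= 1 by rewrite ler_pdivrMr// mul1r ler_nat.
have o1_lt : \forall N \near \oo, ln (C * ln N%:R) / ln (N%:R : R) < a.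
  by apply: cvgr_lt a0; exact: cvg_ln_div_ln.
have ln_large : \forall N \near \oo, 1 <= ln (N%:R : R).
  by apply: cvgry_ge; exact: cvgy_ln_natr.
move: ln_large o1_lt; apply: filterS2 => N u1.
rewrite -/a; set o1 := _ / ln _ => o1a.
have N0 : 0 < N%:R :> R.
  by rewrite lt0r ler0n andbT; apply: contraTneq u1 => ->; rewrite ln0// ler10.
have N1 : 1 <= N%:R :> R by rewrite ler1n -(ltr0n R).
have Cu0 : 0 < C * ln N%:R by rewrite mulr_gt0//; lra.
have N_o1 : N%:R `^ o1 = C * ln N%:R.
  by rewrite /powR gt_eqF// /o1 mulfVK ?gt_eqF ?lnK ?posrE//; lra.
set x := _ `^ _.
have xE : x = N%:R `^ a / (C * ln N%:R).
  by rewrite /x powRB ?N_o1// (gt_eqF N0) implybT.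
have x1 : 1 <= x.
  by rewrite /x -[leLHS](powRr0 N%:R) ler_powR// subr_ge0 ltW.
pose q := Num.truncn (2 * x).
have /andP[q_le q_gt] : q%:R <= 2 * x < q.+1%:R.
  by apply: truncn_itv; lra.
have q1 : (1 < q)%N.
  by rewrite -ltnS -(ltr_nat R) -natr1; apply: le_lt_trans q_gt; lra.
have xq : x <= q%:R by move: q_gt; rewrite -natr1; lra.
apply: (le_trans xq); rewrite ler_nat; apply: solvable_leq_HG (ltnW q1) _.
apply: (@solvable_K_balanced R) => //.
have C16 : 16 <= C by rewrite /C ler_peMr// ler1n.
have qN : q%:R <= N%:R :> R.
  apply: (le_trans q_le); rewrite xE mulrA ler_pdivrMr//.
  have NaN : N%:R `^ a <= N%:R :> R by exact: ler1_powR.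
  apply: (@le_trans _ _ (N%:R * 2)); first by lra.
  by rewrite ler_pM2l//; have := ler_peMr (ltW C0) u1; lra.
have qlnq_le : q%:R * ln q%:R <= N%:R `^ a / (8 * t.+1%:R) :> R.
  apply: (@le_trans _ _ (2 * x * ln N%:R)).
    apply: ler_pM => //; first by rewrite ln_ge0// ler1n ltnW.
    by rewrite ler_ln ?posrE// ltr0n ltnW.
  rewrite xE /C le_eqVlt; apply/orP; left; apply/eqP.
  by field; rewrite !gt_eqF//; lra.
set K := 8 * t.+1%:R in qlnq_le *.
have K1 : 1 <= K by rewrite /K -natrM ler1n.
have K0 : 0 < K by lra.
(* [K <= K ^ (1/a)], so the power [1/a] of [N ^ a / K] is at most [N / K]. *)
have aV : t.+1%:R / t%:R = a^-1 :> R by rewrite /a invf_div.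
have aV1 : 1 <= a^-1 by rewrite invf_ge1.
have -> : N%:R = K * (N%:R / K) :> R by rewrite mulrC divfK ?gt_eqF.
rewrite ler_pM2l// aV.
apply: (@le_trans _ _ ((N%:R `^ a / K) `^ a^-1)).
  rewrite ge0_ler_powR ?invr_ge0 ?(ltW a0)// nnegrE.
    by rewrite mulr_ge0// ln_ge0// ler1n ltnW.
  by rewrite divr_ge0 ?powR_ge0// ltW.
rewrite powRM ?powR_ge0 ?invr_ge0 ?(ltW K0)// -powRrM divff ?gt_eqF//.
rewrite powRr1// ler_pM2l// ge1r_powR// invr_gt0 K0/= invf_le1//.
Qed.

Theorem theorem1p2 (R : realType) :
  (forall r : nat, (2 <= r)%N ->
     exists2 c : R, 0 < c &
       forall q : nat, (2 <= q)%N ->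
         let L : R := q%:R * ln q%:R in
         let m : nat := `|Num.ceil ((2 * L) `^ (1 / (r%:R - 1)))|%N in
         let n : nat := `|Num.ceil (c * r%:R * L `^ (r%:R / (r%:R - 1)))|%N in
         (q <= HG (K_one_large r m n))%N)
  /\
  (forall r : nat, (2 <= r)%N ->
     exists2 o1 : nat -> R, o1 n @[n --> \oo] --> (0 : R) &
       \forall n \near \oo,
         (n%:R : R) `^ ((r%:R - 1) / r%:R - o1 n)
           <= (HG (K_balanced r n))%:R).
Proof.
have predR (t : nat) : t.+1%:R - 1 = t%:R :> R by rewrite -natr1 addrK.
split=> -[//|t] t0; rewrite predR.
  exists 8 => // q q1; apply: solvable_leq_HG (ltnW q1) _.
  exact: solvable_K_one_large_ceil.
exists (fun n => ln (16 * t.+1%:R * ln n%:R) / ln n%:R).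
  by apply: cvg_ln_div_ln; rewrite mulr_gt0// ltr0n.
exact: HG_K_balanced_ge.
Qed.
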